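(* Let $p$ be an odd prime, let $\ell\ge 1$ and $\lambda$ be integers, and let $L$, $N$ be integers with $0\le L<L+N<p$. Let $J_\ell(L,N;\lambda)$ be the number of $2\ell$-tuples of integers $(n_1,\ldots,n_{2\ell})$ with $L+1\le n_1,\ldots,n_{2\ell}\le L+N$ satisfying $$\sum_{i=1}^{\ell} n_i! \equiv \sum_{i=\ell+1}^{2\ell} n_i! + \lambda \pmod p.$$ Then $J_\ell(L,N;\lambda)\ll N^{2\ell-1+1/(\ell+1)}$.
   Context: The notation $U\ll V$ means $|U|\le cV$ for some constant $c>0$; here $c$ may depend on $\ell$ only (not on $p$, $L$, $N$, $\lambda$). *)

(* Defs.v *)
From mathcomp Require Import all_boot all_order all_algebra.
From mathcomp Require Import reals exp.

Set Implicit Arguments.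
Unset Strict Implicit.
Unset Printing Implicit Defensive.

Import Order.TTheory GRing.Theory Num.Theory.

Local Open Scope ring_scope.

(* The number of 2l-tuples (n_1, ..., n_{2l}) of integers in [L + 1, L + N]
   with n_1! + ... + n_l! = n_{l+1}! + ... + n_{2l}! + lambda modulo p.
   The index n_{i+1} of the usual numbering is [n i] for [i : 'I_(2 * l)]; the
   codomain 'I_(L + N).+1 is only there to make the set of tuples finite. *)
Definition J (p l L N : nat) (lambda : int) : nat :=
  #|[set n : {ffun 'I_(2 * l) -> 'I_(L + N).+1} |
      [forall i, (L + 1 <= n i <= L + N)%N] &&
      (\sum_(i < 2 * l | (i < l)%N) ((n i)`!)%:Z
        == \sum_(i < 2 * l | (l <= i)%N) ((n i)`!)%:Z + lambda
        %[mod p%:Z])%Z]|.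

(* Main.v *)
(* Put H = floor (N^(1/(l+1))) and cut [L + 1, L + N] into W <= 2N/H windows of
   length H.  Write J as the mean over the additive characters of F_p of the
   2l-th power of the sum over factorials, with phase given by lambda.  The
   triangle inequality removes the phase, and the power mean inequality applied
   to the splitting into windows gives J <= W^(2l-1) T, where T counts the
   solutions with lambda = 0 whose 2l entries lie in one common window.
   In T, a tuple taking each of its values at least twice has at most l distinct
   values, so there are O(W H^l) of those.  For the others, let m be the least
   entry and n_i = m + h_i with h_i < H; as (m + h)! = m! (m + 1) ... (m + h),
   the congruence says that m is a root modulo p of a combination of the
   rising factorials of degrees h_i.  Polynomials of distinct degrees are
   independent and some value h_i occurs once, so this combination is nonzero of
   degree < H: each of the O(H^(2l-1)) shift vectors h, one entry of which is 0,
   allows fewer than H values of m.  Hence T = O(W H^l + H^(2l)), and the two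
   terms balance for H^(l+1) ~ N. *)
Require Import Defs.
From mathcomp Require Import all_boot all_order all_algebra all_field.
From mathcomp Require Import reals exp ring zify.

Set Implicit Arguments.
Unset Strict Implicit.
Unset Printing Implicit Defensive.

Import Order.TTheory GRing.Theory Num.Theory.

Local Open Scope ring_scope.

(** * The power mean inequality *)

Lemma chebyshev_pow (R : numDomainType) (x y : R) (k : nat) :
  0 <= x -> 0 <= y -> 0 <= (x - y) * (x ^+ k - y ^+ k).
Proof.
move=> x0 y0; rewrite subrXX mulrA -expr2 mulr_ge0 //.
  by rewrite real_exprn_even_ge0 // realB // ger0_real.
by apply: sumr_ge0 => i _; rewrite mulr_ge0 // exprn_ge0.
Qed.

(** Induction on [k]; each step is Chebyshev's sum inequality, since the double sum of the
    nonnegative products of [chebyshev_pow] is twice the difference of its two sides. *)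
Lemma power_mean (R : numDomainType) (I : finType) (x : I -> R) (k : nat) :
  (forall i, 0 <= x i) ->
  (\sum_i x i) ^+ k.+1 <= #|I|%:R ^+ k * \sum_i x i ^+ k.+1.
Proof.
move=> x0; elim: k => [|k IHk]; first by rewrite mul1r expr1.
have step : (\sum_i x i) * (\sum_i x i ^+ k.+1)
    <= #|I|%:R * \sum_i x i ^+ k.+2.
  have: 0 <= \sum_i \sum_j (x i - x j) * (x i ^+ k.+1 - x j ^+ k.+1).
    by do 2!(apply: sumr_ge0 => ? _); apply: chebyshev_pow.
  suff -> : \sum_i \sum_j (x i - x j) * (x i ^+ k.+1 - x j ^+ k.+1)
      = (#|I|%:R * \sum_i x i ^+ k.+2 - (\sum_i x i) * \sum_i x i ^+ k.+1) *+ 2.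
    by rewrite pmulrn_lge0 // subr_ge0.
  set X := \sum_i x i; set Y := \sum_i x i ^+ k.+1; set Z := \sum_i _ ^+ k.+2.
  have inner i : \sum_j (x i - x j) * (x i ^+ k.+1 - x j ^+ k.+1)
      = #|I|%:R * x i ^+ k.+2 - x i * Y - X * x i ^+ k.+1 + Z.
    have -> : #|I|%:R * x i ^+ k.+2 = \sum_(j : I) x i ^+ k.+2.
      by rewrite sumr_const mulr_natl.
    rewrite mulr_sumr mulr_suml -!sumrB -big_split /=.
    by apply: eq_bigr => j _; rewrite !(exprS _ k.+1); ring.
  under eq_bigr do rewrite inner.
  rewrite big_split sumr_const !sumrB -mulr_suml -!mulr_sumr -/X -/Y -/Z.
  have -> : Z *+ #|xpredT : pred I| = #|I|%:R * Z by rewrite mulr_natl.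
  by rewrite /=; ring.
have sum0 : 0 <= \sum_i x i by apply: sumr_ge0.
rewrite exprS; apply: le_trans (ler_wpM2l sum0 IHk) _.
by rewrite mulrCA [in leRHS]exprSr -mulrA ler_wpM2l // exprn_ge0.
Qed.

(** * Additive characters of F_p and the circle method *)

Section AdditiveCharacter.

Variable p : nat.
Hypothesis p_pr : prime p.

Definition chi (x : 'F_p) : algC :=
  sval (C_prim_root_exists (prime_gt0 p_pr)) ^+ x.

Lemma chiP : p.-primitive_root (sval (C_prim_root_exists (prime_gt0 p_pr))).
Proof. by rewrite /sval; case: C_prim_root_exists. Qed.

Lemma chi0 : chi 0 = 1.
Proof. by rewrite /chi expr0. Qed.

Lemma chiD (x y : 'F_p) : chi (x + y) = chi x * chi y.
Proof.
rewrite /chi -exprD /= -[in RHS](prim_expr_mod chiP).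
by rewrite [X in (_ %% X)%N](Fp_cast p_pr).
Qed.

Lemma chi_sum (I : finType) (f : I -> 'F_p) :
  chi (\sum_i f i) = \prod_i chi (f i).
Proof. exact: (big_morph _ chiD chi0). Qed.

Lemma norm_chi (x : 'F_p) : `|chi x| = 1.
Proof.
rewrite normrX; suff -> : `|sval (C_prim_root_exists (prime_gt0 p_pr))| = 1.
  by rewrite expr1n.
apply/eqP; rewrite -(pexpr_eq1 (prime_gt0 p_pr)) // -normrX.
by rewrite (prim_expr_order chiP) normr1.
Qed.

Lemma chiN (x : 'F_p) : chi (- x) = (chi x)^*.
Proof.
have chi_n0 : chi x != 0 by rewrite -normr_eq0 norm_chi oner_eq0.
apply: (mulfI chi_n0); rewrite -chiD subrr chi0.
by rewrite -normCK norm_chi expr1n.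
Qed.

Lemma sum_chi (x : 'F_p) : \sum_a chi (a * x) = (x == 0)%:R * p%:R.
Proof.
have [->|x0] := eqVneq x 0.
  under eq_bigr do rewrite mulr0 chi0.
  by rewrite sumr_const card_Fp // mul1r.
rewrite mul0r.
have -> : \sum_a chi (a * x) = \sum_a chi a.
  by rewrite [RHS](reindex_inj (mulIf x0)).
have chi1 : chi 1 != 1.
  rewrite /chi -(prim_order_dvd chiP) dvdn1 /=.
  by apply: contraL p_pr => /eqP ->.
(* Multiplying by [chi 1] only translates the summation variable, and [chi 1 != 1], so the sum
   vanishes. *)
have : chi 1 * \sum_a chi a = \sum_a chi a.
  rewrite mulr_sumr [RHS](reindex_inj (addrI 1)) /=.
  by apply: eq_bigr => a _; rewrite chiD.
move/eqP; rewrite -subr_eq0 -[X in _ - X]mul1r -mulrBl mulf_eq0.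
by rewrite subr_eq0 (negPf chi1) => /eqP.
Qed.

Section Solutions.

Variables (A I : finType) (f : A -> 'F_p) (s : I -> bool).

(** [s] marks the variables that carry a minus sign, those on the right of the congruence. *)
Definition solutions (B : {set A}) (lam : 'F_p) : {set {ffun I -> A}} :=
  [set n in ffun_on B | \sum_i (-1) ^+ s i * f (n i) == lam].

Definition expsum (B : {set A}) (a : 'F_p) : algC :=
  \sum_(x in B) chi (a * f x).

Lemma expsum_sign (B : {set A}) (a : 'F_p) (b : bool) :
  \sum_(x in B) chi (a * ((-1) ^+ b * f x))
  = if b then (expsum B a)^* else expsum B a.
Proof.
case: b; rewrite /expsum ?rmorph_sum; apply: eq_bigr => x _.
  by rewrite expr1 mulN1r mulrN chiN.
by rewrite expr0 mul1r.
Qed.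

(** Orthogonality detects the equation; a variable with a minus sign contributes the conjugate
    sum. *)
Lemma card_solutionsE (B : {set A}) (lam : 'F_p) :
  #|solutions B lam|%:R * p%:R
  = \sum_a chi (- (a * lam))
      * \prod_i (if s i then (expsum B a)^* else expsum B a).
Proof.
have prodE a : \prod_i (if s i then (expsum B a)^* else expsum B a)
    = \sum_(n : {ffun I -> A} | n \in ffun_on B)
        chi (a * \sum_i (-1) ^+ s i * f (n i)).
  under eq_bigr do rewrite -expsum_sign.
  rewrite bigA_distr_big; apply: eq_bigr => n _.
  by rewrite mulr_sumr chi_sum.
under [RHS]eq_bigr => a _.
  rewrite prodE mulr_sumr.
  under eq_bigr do rewrite -chiD -mulrN -mulrDr.
  over.
rewrite exchange_big /=.
under eq_bigr do rewrite sum_chi addrC subr_eq0.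
rewrite -mulr_suml -natr_sum; congr (_%:R * _).
rewrite -sum1_card [RHS]big_mkcond [LHS]big_mkcond /=.
by apply: eq_bigr => n _; rewrite inE; case: (n \in _); case: (_ == lam).
Qed.

Variable l : nat.
Hypotheses (sT : #|[pred i | s i]| = l.+1) (sF : #|[pred i | ~~ s i]| = l.+1).

Lemma prod_signs (R : comNzRingType) (x y : R) :
  \prod_i (if s i then x else y) = (x * y) ^+ l.+1.
Proof.
rewrite (bigID s) /= exprMn -{1}sT -sF -!prodr_const /=.
by congr (_ * _); apply: eq_bigr => i; [move=> -> | move=> /negPf ->].
Qed.

Lemma card_solutions_le (B : {set A}) (lam : 'F_p) :
  #|solutions B lam|%:R * p%:R <= \sum_a `|expsum B a | ^+ (l.+1).*2.
Proof.
rewrite -[leLHS]ger0_norm ?mulr_ge0 ?ler0n // card_solutionsE.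
apply: le_trans (ler_norm_sum _ _ _) _; apply: ler_sum => a _.
rewrite normrM norm_chi mul1r prod_signs normrX normrM norm_conjC.
by rewrite -expr2 -exprM mul2n.
Qed.

Lemma card_solutions0 (B : {set A}) :
  #|solutions B 0|%:R * p%:R = \sum_a `|expsum B a | ^+ (l.+1).*2.
Proof.
rewrite card_solutionsE; apply: eq_bigr => a _.
rewrite mulr0 oppr0 chi0 mul1r prod_signs -normCKC.
by rewrite -exprM mul2n.
Qed.

(** With [lam = 0] the moment of the exponential sum is exactly a count, so after splitting by [g]
    the moment of each piece turns back into solutions inside one window. *)
Lemma card_solutions_windows (W : finType) (g : A -> W) (B : {set A})
    (lam : 'F_p) :
  (#|solutions B lam| <= #|W| ^ (l.*2.+1)
      * \sum_w #|solutions [set x in B | g x == w] 0%R|)%N.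
Proof.
have p0 : 0 < p%:R :> algC by rewrite ltr0n prime_gt0.
rewrite -(ler_nat algC) -(ler_pM2r p0).
apply: le_trans (card_solutions_le _ _) _.
rewrite natrM natrX natr_sum -mulrA mulr_suml.
under [in leRHS]eq_bigr do rewrite card_solutions0.
rewrite exchange_big mulr_sumr /=; apply: ler_sum => a _.
rewrite /expsum (partition_big g xpredT) //=.
apply: (@le_trans _ _
  ((\sum_w `|\sum_(x in B | g x == w) chi (a * f x)|) ^+ (l.+1).*2)).
  by rewrite lerXn2r ?nnegrE ?sumr_ge0 // ler_norm_sum.
apply: le_trans (power_mean _ _) _ => //.
rewrite ler_wpM2l ?exprn_ge0 ?ler0n // le_eqVlt; apply/orP; left; apply/eqP.
by apply: eq_bigr => w _; congr (`|_| ^+ _); apply: eq_bigl => x; rewrite inE.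
Qed.

End Solutions.

End AdditiveCharacter.

(** * Tuples in which every value is repeated *)

Definition paired (I : finType) (A : eqType) (n : I -> A) : bool :=
  [forall i, exists j, (j != i) && (n j == n i)].

Lemma card_codom_paired (I A : finType) (n : {ffun I -> A}) :
  paired n -> (2 * #|n @: I| <= #|I|)%N.
Proof.
move=> /forallP n_paired.
rewrite -[leqRHS]sum1_card (partition_big_imset n) mulnC -sum_nat_const /=.
apply: leq_sum => y /imsetP[i _ ->].
have /existsP[j /andP[ji nji]] := n_paired i.
by rewrite (bigD1 i) ?eqxx //= (bigD1 j) ?nji ?ji.
Qed.

(** Such a tuple has at most [#|J|] values, so it factors through [J]: [g] lists the values and [f]
    gives the position of each entry in the list. *)
Lemma card_paired (A I J : finType) (B : {set A}) :
  (0 < #|I| <= 2 * #|J|)%N ->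
  (#|[set n : {ffun I -> A} in ffun_on B | paired n]|
    <= #|J| ^ #|I| * #|B| ^ #|J|)%N.
Proof.
case/andP=> /card_gt0P[i0 _] IJ.
rewrite -card_ffun -(card_ffun_on J B) -cardsT.
rewrite -[X in (_ * X)%N]cardsE -cardsX.
pose comp (fg : {ffun I -> J} * {ffun J -> A}) := [ffun i => fg.2 (fg.1 i)].
apply: leq_trans (leq_imset_card comp _); apply/subset_leq_card/subsetP => n.
rewrite inE => /andP[/ffun_onP nB /card_codom_paired nI].
have leEJ : (#|n @: I| <= #|J|)%N.
  by rewrite -(leq_pmul2l (isT : 0 < 2)%N) (leq_trans nI).
have ltJ i : (index (n i) (enum (n @: I)) < #|J|)%N.
  by apply: leq_trans leEJ; rewrite cardE index_mem mem_enum imset_f.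
pose f := [ffun i => enum_val (Ordinal (ltJ i))].
(* The default [n i0] keeps [g] inside [B] at the labels beyond the list. *)
pose g := [ffun j : J => nth (n i0) (enum (n @: I)) (enum_rank j)].
apply/imsetP; exists (f, g).
  rewrite !inE /=; apply/ffun_onP => j; rewrite ffunE.
  have [jE|Ej] := ltnP (enum_rank j) (size (enum (n @: I))).
    have := mem_nth (n i0) jE; rewrite mem_enum => /imsetP[i _ ->]; exact: nB.
  by rewrite nth_default.
apply/ffunP => i; rewrite !ffunE enum_valK /= nth_index //.
by rewrite mem_enum imset_f.
Qed.

(** * Rising factorials and their linear independence *)

Definition rising (R : nzRingType) (h : nat) : {poly R} :=
  \prod_(j < h) ('X + (j.+1)%:R%:P).

Lemma size_rising (R : nzRingType) (h : nat) : size (rising R h) = h.+1.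
Proof.
rewrite /rising; under eq_bigr do rewrite -[_%:P]opprK -polyCN.
by rewrite size_prod_XsubC -[index_enum _]enumT size_enum_ord.
Qed.

Lemma fact_rising (R : comNzRingType) (m h : nat) :
  (m + h)`!%:R = m`!%:R * (rising R h).[m%:R].
Proof.
elim: h => [|h IHh]; first by rewrite addn0 /rising big_ord0 hornerC mulr1.
rewrite addnS factS natrM IHh /rising big_ord_recr hornerM !hornerE /=.
by rewrite -addnS natrD -mulrA mulrC.
Qed.

(** Only the last polynomial reaches the top degree, so its coefficient vanishes; then descend. *)
Lemma poly_echelon_free (R : idomainType) (P : nat -> {poly R}) (c : nat -> R)
    (n : nat) :
  (forall v, size (P v) = v.+1) -> \sum_(v < n) c v *: P v = 0 ->
  forall v, (v < n)%N -> c v = 0.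
Proof.
move=> sizeP; elim: n => [//|n IHn]; rewrite big_ord_recr /= => sum0.
suff cn : c n = 0.
  move=> v; rewrite ltnS leq_eqVlt => /orP[/eqP->//|]; apply: IHn.
  by move: sum0; rewrite cn scale0r addr0.
have := congr1 (coefp n) sum0.
rewrite /= coefD coef_sum coefZ coef0 big1 ?add0r => [/eqP|i _]; last first.
  by rewrite coefZ nth_default ?mulr0 // sizeP.
rewrite mulf_eq0 => /orP[/eqP//|].
have := lead_coef_eq0 (P n); rewrite lead_coefE sizeP /= => ->.
by rewrite -size_poly_eq0 sizeP.
Qed.

Lemma sum_rising_neq0 (R : idomainType) (I : finType) (s : I -> bool)
    (h : I -> nat) :
  ~~ paired h -> \sum_i (-1) ^+ s i *: rising R (h i) != 0.
Proof.
move=> /forallPn[i0 /existsPn i0P]; apply/eqP => sum0.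
(* Signs are grouped by degree; the isolated degree [h i0] gets a single sign, which is nonzero. *)
pose c (v : nat) : R := \sum_(i | h i == v) (-1) ^+ s i.
pose H := (\max_i h i).+1.
have hH i : (h i < H)%N by rewrite ltnS; apply: leq_bigmax.
have: \sum_(v < H) c v *: rising R v = 0.
  rewrite -[RHS]sum0 (partition_big (fun i => Ordinal (hH i)) xpredT) //=.
  apply: eq_bigr => v _; rewrite scaler_suml.
  by apply: eq_big => [i|i /eqP ->//]; rewrite -val_eqE.
move/(poly_echelon_free (size_rising R))/(_ _ (hH i0))/eqP.
rewrite /c (bigD1 i0) //= big1 ?addr0 ?signr_eq0 // => i /andP[hi ii0].
by have := i0P i; rewrite hi ii0.
Qed.

Lemma size_sum_rising (R : idomainType) (I : finType) (s : I -> bool)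
    (h : I -> nat) (H : nat) :
  (forall i, h i < H)%N ->
  (size (\sum_i (-1) ^+ s i *: rising R (h i))%R <= H)%N.
Proof.
move=> hH; apply: leq_trans (size_sum _ _ _) _; apply/bigmax_leqP => i _.
by apply: leq_trans (size_scale_leq _ _) _; rewrite size_rising.
Qed.

Lemma card_bigcup_le (I A : finType) (P : pred I) (F : I -> {set A}) :
  (#|\bigcup_(i | P i) F i| <= \sum_(i | P i) #|F i|)%N.
Proof.
elim/big_ind2: _ => [|m X n Y Xm Yn|//]; first by rewrite cards0.
by apply: leq_trans (leq_card_setU X Y) _; apply: leq_add.
Qed.

(** * Solutions in a short interval with an isolated value *)

Section Unpaired.

Variable p : nat.
Hypothesis p_pr : prime p.

Lemma Fp_nat_inj (a b : nat) : (a < p)%N -> (b < p)%N ->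
  a%:R = b%:R :> 'F_p -> a = b.
Proof.
move=> ap bp /(congr1 (@nat_of_ord _)).
by rewrite !val_Fp_nat // !modn_small.
Qed.

Lemma fact_Fp_neq0 (m : nat) : (m < p)%N -> m`!%:R != 0 :> 'F_p.
Proof.
elim: m => [|m IHm] mp; first by rewrite oner_eq0.
rewrite factS natrM mulf_neq0 ?IHm 1?ltnW //.
by apply/eqP => /(@Fp_nat_inj m.+1 0%N mp (prime_gt0 p_pr)).
Qed.

Lemma card_roots (M : nat) (Q : {poly 'F_p}) : (M <= p)%N -> Q != 0 ->
  (#|[set m : 'I_M | root Q m%:R]| < size Q)%N.
Proof.
move=> Mp Q0; rewrite cardE -(size_map (fun m : 'I_M => m%:R : 'F_p)).
apply: max_poly_roots => //.
  by apply/allP => x /mapP[m]; rewrite mem_enum inE => mQ ->.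
rewrite map_inj_uniq ?enum_uniq // => a b /Fp_nat_inj ab.
by apply/val_inj/ab; apply: leq_trans Mp.
Qed.

Variables (I : finType) (s : I -> bool) (M H : nat).

(** Bounding differences by [H] instead of fixing a window lets one set hold the solutions from all
    windows. *)
Definition unpaired_solutions : {set {ffun I -> 'I_M}} :=
  [set n : {ffun I -> 'I_M} |
    [&& [forall i, forall j, (n i < n j + H.+1)%N], ~~ paired n
      & \sum_i (-1) ^+ s i * (n i)`!%:R == 0 :> 'F_p]].

Let shifts (i0 : I) : {pred {ffun I -> 'I_H.+1}} :=
  pffun_on ord0 (predC1 i0) predT.

Let shift_poly (h : {ffun I -> 'I_H.+1}) : {poly 'F_p} :=
  \sum_i (-1) ^+ s i *: rising 'F_p (h i).

(** The tuple is recovered from its least entry [n i0] and its shifts. The shift at [i0] is 0, and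
    each shift vector allows at most [H.+1] roots, which makes up for the lost coordinate. *)
Lemma card_unpaired_min (i0 : I) : (M <= p)%N ->
  (#|[set n : {ffun I -> 'I_M} in unpaired_solutions |
        [forall i, (n i0 <= n i)%N]]|
    <= H.+1 ^ #|I|)%N.
Proof.
move=> Mp; set X := [set n in _ | _].
pose shift (n : {ffun I -> 'I_M}) : {ffun I -> 'I_H.+1} :=
  [ffun i => inord (n i - n i0)].
have shiftE n : n \in X -> forall i, (n i = n i0 + shift n i :> nat)%N.
  rewrite !inE => /andP[/and3P[/forallP nH _ _] /forallP n_min] i.
  rewrite ffunE inordK ?subnKC //.
  by have /forallP/(_ i0) := nH i; rewrite ltn_subLR.
pose Y := [set hm : {ffun I -> 'I_H.+1} * 'I_M |
  [&& hm.1 \in shifts i0, shift_poly hm.1 != 0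
    & root (shift_poly hm.1) hm.2%:R]].
have XY : (#|X| <= #|Y|)%N.
  rewrite -(@card_in_imset _ _ (fun n : {ffun I -> 'I_M} => (shift n, n i0)) X).
    apply/subset_leq_card/subsetP => _ /imsetP[n nX ->].
    have nE := shiftE n nX.
    move: nX; rewrite !inE => /andP[/and3P[_ n_unpaired /eqP n_sum] _].
    apply/and3P; split=> /=.
    - apply/pffun_onP; split; last by [].
      apply/subsetP => i; rewrite !inE; apply: contraNneq => ->.
      by rewrite ffunE subnn; apply/eqP/val_inj; rewrite /= inordK.
    - apply: sum_rising_neq0; apply: contra n_unpaired.
      move=> /forallP shift_paired; apply/forallP => i.
      have /existsP[j /andP[ji nji]] := shift_paired i.
      apply/existsP; exists j; rewrite ji -val_eqE /=.
      by rewrite (nE i) (nE j) (eqP nji).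
    (* As [n i0 < p], the common factor [(n i0)!] is invertible modulo [p] and can be cancelled. *)
    - have fact0 := fact_Fp_neq0 (leq_trans (ltn_ord (n i0)) Mp).
      rewrite /root -(mulrI_eq0 _ (mulfI fact0)) -n_sum /shift_poly horner_sum.
      rewrite mulr_sumr; apply/eqP/eq_bigr => i _.
      by rewrite hornerZ mulrCA -fact_rising -nE.
  move=> n1 n2 /shiftE n1E /shiftE n2E [sh n0].
  by apply/ffunP => i; apply/val_inj; rewrite /= n1E n2E sh n0.
apply: leq_trans XY _.
have -> : #|Y| = (\sum_(h in shifts i0 | shift_poly h != 0%R)
    #|[set m : 'I_M | root (shift_poly h) m%:R]|)%N.
  under [RHS]eq_bigr do rewrite -sum1_card.
  rewrite -sum1_card pair_big_dep; apply: eq_bigl => hm.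
  by rewrite !inE andbA.
apply: (@leq_trans (\sum_(h in shifts i0) H.+1)%N).
  rewrite big_mkcondr; apply: leq_sum => h _; case: ifP => // Q0.
  apply: leq_trans (ltnW (card_roots Mp Q0)) _.
  by apply: size_sum_rising => i; apply: ltn_ord.
rewrite sum_nat_const card_pffun_on card_ord -expnSr cardC1.
by rewrite prednK //; apply/card_gt0P; exists i0.
Qed.

Lemma card_unpaired : (M <= p)%N -> (0 < #|I|)%N ->
  (#|unpaired_solutions| <= #|I| * H.+1 ^ #|I|)%N.
Proof.
move=> Mp /card_gt0P[i0 _]; rewrite -sum_nat_const.
apply: leq_trans _ (leq_sum _ (fun i _ => card_unpaired_min i Mp)).
apply: leq_trans _ (card_bigcup_le _ _); apply/subset_leq_card/subsetP => n nX.
have [i _ i_min] := arg_minnP (fun i => n i : nat) (isT : xpredT i0).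
by apply/bigcupP; exists i; rewrite // inE nX; apply/forallP => j; apply: i_min.
Qed.

End Unpaired.

(** * Application to [J] and choice of the window length *)

Lemma card_ord_ge (l : nat) :
  #|[pred i : 'I_(2 * l) | (l <= i)%N]| = l
  /\ #|[pred i : 'I_(2 * l) | ~~ (l <= i)%N]| = l.
Proof.
rewrite -!sum1_card [X in X = _ /\ _]big_mkcond [X in _ /\ X = _]big_mkcond /=.
rewrite mul2n -addnn !big_split_ord /=.
split.
  rewrite [X in (X + _)%N]big1 => [|i _]; last by rewrite inE /= leqNgt ltn_ord.
  by under eq_bigr do rewrite inE /= leq_addr; rewrite sum1_card card_ord.
rewrite [X in (_ + X)%N]big1 => [|i _]; last by rewrite inE /= leq_addr.
under eq_bigr do rewrite inE /= -ltnNge ltn_ord.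
by rewrite sum1_card card_ord addn0.
Qed.

Lemma J_solutions (p l L N : nat) (lambda : int) : prime p ->
  J p l L N lambda
  = #|solutions (fun x : 'I_(L + N).+1 => x`!%:R : 'F_p)
        (fun i : 'I_(2 * l) => (l <= i)%N) [set x : 'I__ | (L < x)%N]
        (lambda%:~R)|.
Proof.
move=> p_pr; apply: eq_card => n; rewrite !inE; congr (_ && _).
  apply/forallP/ffun_onP => nB i; have := nB i; rewrite inE addn1.
    by case/andP.
  by move=> ->; rewrite -ltnS ltn_ord.
rewrite eqz_mod_dvd (dvdz_pcharf (pchar_Fp p_pr)) opprD addrA rmorphB /=.
rewrite subr_eq0; congr (_ == _).
rewrite rmorphB !rmorph_sum /=.
rewrite [RHS](bigID (fun i : 'I_(2 * l) => (i < l)%N)) /=.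
rewrite -sumrN; congr (_ + _).
  by apply: eq_bigr => i il; rewrite leqNgt il expr0 mul1r.
apply: eq_big => [i|i il]; first by rewrite leqNgt.
by rewrite il expr1 mulN1r.
Qed.

Lemma J_le_windows (p k L N h : nat) (lambda : int) :
  prime p -> (0 < N)%N -> (L + N < p)%N ->
  let l := k.+1 in let W := (N.-1 %/ h.+1).+1 in
  (J p l L N lambda <= W ^ k.*2.+1
     * (W * (l ^ (2 * l) * h.+1 ^ l) + 2 * l * h.+1 ^ (2 * l)))%N.
Proof.
move=> p_pr N0 Np /=; set l := k.+1; set W := (_ %/ _).+1.
rewrite J_solutions //.
have [sT sF] := card_ord_ge l.
(* Index of the window containing [x]. Truncated subtraction sends every [x <= L] to window 0, but
   [B] excludes these. *)
pose g (x : 'I_(L + N).+1) : 'I_W := inord ((x - L.+1) %/ h.+1).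
have gE x : g x = ((x - L.+1) %/ h.+1)%N :> nat.
  rewrite inordK // ltnS leq_div2r //; have := ltn_ord x; lia.
apply: leq_trans (card_solutions_windows p_pr _ sT sF g _ _) _.
rewrite card_ord leq_pmul2l ?expn_gt0 //.
set B := [set x : 'I__ | (L < x)%N].
set f := fun x => _ : 'F_p; set s := fun i : 'I_(2 * l) => (l <= i)%N.
have i0 : 'I_(2 * l) by apply: (@Ordinal _ 0).
have card_window w : (#|[set x in B | g x == w]| <= h.+1)%N.
  rewrite -[leqRHS]card_ord.
  apply: (@leq_card_in _ _ (fun x : 'I_(L + N).+1 =>
    inord ((x - L.+1) %% h.+1) : 'I_h.+1)).
  move=> x y; rewrite !inE => /andP[Lx /eqP gx] /andP[Ly /eqP gy].
  move=> /(congr1 (@nat_of_ord _)); rewrite !inordK ?ltn_pmod // => xy.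
  apply/val_inj; rewrite /= -(subnK Lx) -(subnK Ly).
  rewrite (divn_eq (x - _) h.+1) (divn_eq (y - _) h.+1) xy -!gE gx gy //.
pose window w := [set x in B | g x == w].
have paired_le w :
  (#|[set n in solutions f s (window w) 0%R | paired n]|
    <= l ^ (2 * l) * h.+1 ^ l)%N.
  apply: (@leq_trans #|[set n : {ffun 'I_(2 * l) -> _} in
      ffun_on [set x in B | g x == w] | paired n]|).
    apply/subset_leq_card/subsetP => n.
    by rewrite !inE => /andP[/andP[-> _] ->].
  apply: leq_trans (@card_paired _ _ 'I_l _ _) _.
    by rewrite !card_ord leqnn.
  by rewrite !card_ord leq_pmul2l ?expn_gt0 // leq_exp2r.
have unpaired_le :
  (\sum_w #|[set n in solutions f s (window w) 0%R | ~~ paired n]|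
    <= 2 * l * h.+1 ^ (2 * l))%N.
  have := card_unpaired p_pr s h Np; rewrite card_ord => /(_ isT).
  apply: leq_trans; rewrite -[leqRHS]sum1_card.
  (* The window of a tuple is read off one entry, so the sets for different [w] are disjoint parts
     of [unpaired_solutions] and no factor [W] is lost. *)
  pose first_window (n : {ffun 'I_(2 * l) -> _}) := g (n i0).
  rewrite (partition_big first_window xpredT) //= /first_window.
  apply: leq_sum => w _; rewrite sum1_card; apply/subset_leq_card/subsetP => n.
  rewrite !inE => /andP[/andP[/ffun_onP nB n_sum] n_unpaired].
  have {}nB i : (L < n i)%N && (g (n i) == w) by have := nB i; rewrite !inE.
  rewrite unfold_in /= inE n_sum n_unpaired.
  have [_ ->] := andP (nB i0); rewrite !andbT.
  apply/forallP => i; apply/forallP => j.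
  have [/andP[Li /eqP gi] /andP[Lj /eqP gj]] := (nB i, nB j).
  have := ltn_ceil (n i - L.+1) (ltn0Sn h).
  have := leq_divM (n j - L.+1) h.+1.
  rewrite -!gE gi gj (mulSn w).
  move: (n i : nat) (n j : nat) (w * h.+1)%N Li Lj; lia.
have -> : (W * (l ^ (2 * l) * h.+1 ^ l)
    = \sum_(w : 'I_W) l ^ (2 * l) * h.+1 ^ l)%N.
  by rewrite sum_nat_const card_ord.
apply: leq_trans _ (leq_add (leq_sum _ (fun w _ => paired_le w)) unpaired_le).
rewrite -big_split /=; apply: leq_sum => w _.
set X := solutions _ _ _ _.
rewrite -(cardsID [set n : {ffun _ -> _} | paired n] X).
by apply: eq_leq; congr (_ + _)%N; apply: eq_card => n; rewrite !inE // andbC.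
Qed.

(** Division by [H ^ l], with [l = k.+1], is cleared so that everything stays in the naturals. *)
Lemma J_mul_le (p k L N H : nat) (lambda : int) :
  prime p -> (L + N < p)%N -> (0 < H)%N -> (H ^ k.+2 <= N)%N ->
  (J p k.+1 L N lambda * H ^ k.+1
    <= 2 ^ (2 * k.+1) * (k.+1 ^ (2 * k.+1) + 2 * k.+1) * N ^ (2 * k.+1))%N.
Proof.
move=> p_pr Np; case: H => // h _ hN.
have N0 : (0 < N)%N by apply: leq_trans hN; rewrite expn_gt0.
have := J_le_windows k h lambda p_pr N0 Np; set W := (_ %/ _).+1 => /= JW.
have HN : (h.+1 <= N)%N.
  by apply: leq_trans hN; rewrite expnS leq_pmulr ?expn_gt0.
have WH : (W * h.+1 <= 2 * N)%N.
  by rewrite mulSn; have := leq_divM N.-1 h.+1; lia.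
(* A second factor [H ^ l] gives [H ^ (2 * l)] in all, enough to pair every [W] with an [H] and use
   [W * H <= 2 * N]. *)
rewrite -(leq_pmul2r (_ : 0 < h.+1 ^ k.+1)%N) ?expn_gt0 //.
rewrite -mulnA -expnD addnn -mul2n.
apply: leq_trans (leq_mul JW (leqnn _)) _.
set l := k.+1 in hN JW *; set A := (l ^ (2 * l))%N.
have -> : (2 * l = k.*2.+1.+1)%N by rewrite /l; lia.
set m := k.*2.+1.
rewrite expnSr.
have -> : (W ^ m * (W * (A * h.+1 ^ l) + m.+1 * (h.+1 ^ m * h.+1))
      * (h.+1 ^ m * h.+1)
    = (W * h.+1) ^ m
      * (W * h.+1 * A * h.+1 ^ l + m.+1 * (h.+1 ^ m * h.+1 * h.+1)))%N.
  by rewrite expnMn; ring.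
(* The unpaired term contains [H ^ (l + 1) <= N], which brings it down to the size of the paired
   one. *)
have -> : (h.+1 ^ m * h.+1 * h.+1 = h.+1 ^ k.+2 * h.+1 ^ l)%N.
  by rewrite -!expnSr -expnD; congr expn; rewrite /m /l; lia.
apply: (@leq_trans ((2 * N) ^ m
  * (2 * N * A * h.+1 ^ l + m.+1 * (2 * N * h.+1 ^ l)))%N).
  have hN2 : (h.+1 ^ k.+2 <= 2 * N)%N.
    by apply: leq_trans hN _; rewrite leq_pmull.
  apply: leq_mul; first by rewrite leq_exp2r.
  apply: leq_add; first by apply: leq_mul => //; apply: leq_mul.
  by apply: leq_mul => //; apply: leq_mul.
by apply: eq_leq; rewrite (expnS 2 m) (expnS N m) expnMn; ring.
Qed.

Theorem theorem1 (R : realType) (l : nat) (hl : (1 <= l)%N) :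
  exists2 c : R, 0 < c &
    forall (p L N : nat) (lambda : int),
      prime p -> odd p ->
      (L < L + N)%N -> (L + N < p)%N ->
      (J p l L N lambda)%:R
        <= c * N%:R `^ ((2 * l)%:R - 1 + 1 / (l + 1)%:R).
Proof.
case: l hl => // k _.
set C := (2 ^ (2 * k.+1) * (k.+1 ^ (2 * k.+1) + 2 * k.+1))%N.
(* [C] comes from [J_mul_le]; the power of 2 is the cost of replacing the real root [x] by [2 * H]
   in [x ^+ k.+1]. *)
exists (2 ^+ k.+1 * C%:R).
  rewrite mulr_gt0 ?exprn_gt0 // ltr0n muln_gt0 expn_gt0 /=.
  by rewrite ltn_addr // expn_gt0.
move=> p L N lambda p_pr _; rewrite -[X in (X < _)%N]addn0 ltn_add2l => N0 Np.
pose P H := (H ^ k.+2 <= N)%N.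
have P1 : exists H, P H by exists 1%N; rewrite /P exp1n.
have ubP H : P H -> (H <= N)%N.
  by apply: leq_trans; case: H => // H; rewrite expnS leq_pmulr // expn_gt0.
(* [H] is the integer part of the [(l + 1)]-th root of [N]; maximality and [H.+1 <= 2 * H] then give
   [x <= 2 * H]. *)
case: (ex_maxnP P1 ubP) => H PH H_max.
have H0 : (0 < H)%N by apply: H_max; rewrite /P exp1n.
have JH := J_mul_le lambda p_pr Np H0 PH.
have NH : (N < (2 * H) ^ k.+2)%N.
  apply: (@leq_trans (H.+1 ^ k.+2)); last by rewrite leq_exp2r //; lia.
  by rewrite ltnNge; apply/negP => /H_max; rewrite ltnn.
set n : R := N%:R; have n0 : 0 < n by rewrite ltr0n.
pose x := n `^ (1 / (k.+1 + 1)%:R).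
have x0 : 0 < x by apply: powR_gt0.
have xn : x ^+ k.+2 = n.
  rewrite -powR_mulrn ?ltW // /x -powRrM addn1 div1r mulVf ?pnatr_eq0 //.
  by rewrite powRr1 // ltW.
have xH : x <= 2 * H%:R.
  rewrite -(@ler_pXn2r _ k.+2) ?nnegrE ?ltW ?mulr_gt0 ?ltr0n // xn.
  by rewrite /n -natrM -natrX ltr_nat.
have -> : n `^ ((2 * k.+1)%:R - 1 + 1 / (k.+1 + 1)%:R) = n ^+ k.*2.+1 * x :> R.
  rewrite powRD; last by apply/implyP => _; rewrite gt_eqF.
  rewrite -/x -powR_mulrn ?ltW //; congr (n `^ _ * _).
  by rewrite (_ : 2 * k.+1 = k.*2.+1.+1)%N ?mulrSr ?addrK //; lia.
(* Multiplying by [x ^+ k.+1] completes [x] to [x ^+ k.+2 = n], leaving an integral power of [n] on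
   the right. *)
rewrite -(ler_pM2r (exprn_gt0 k.+1 x0)) -!mulrA -exprS xn -exprSr.
apply: (@le_trans _ _ ((J p k.+1 L N lambda)%:R * (2 * H%:R) ^+ k.+1)).
  apply: ler_wpM2l => //; apply: lerXn2r => //; rewrite nnegrE ?(ltW x0) //.
  by rewrite mulr_ge0.
rewrite exprMn mulrCA ler_wpM2l ?exprn_ge0 // /n -!natrX -!natrM ler_nat.
by rewrite (_ : k.*2.+2 = 2 * k.+1)%N //; lia.
Qed.
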